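(* Let $T$ be a trigraph in $\mathcal F$ that contains no antihole (of any length $\ge5$) and that is either the complement of a bipartite trigraph or the complement of a line trigraph. Then: (1) $T$ is either complete or has an even pair; (2) if $T$ is favorable, then $T$ has an even pair disjoint from its switchable component.
   Context: A trigraph $T$ consists of a finite set $V(T)$ and a map $\theta:\binom{V(T)}{2}\to\{-1,0,1\}$. Two distinct vertices $u,v$ are strongly adjacent if $\theta(uv)=1$, strongly antiadjacent if $\theta(uv)=-1$, and semiadjacent (a switchable pair) if $\theta(uv)=0$; they are adjacent if $\theta(uv)\in\{0,1\}$ and antiadjacent if $\theta(uv)\in\{0,-1\}$. $N(v)$ is the set of vertices adjacent to $v$. The complement $\overline T$ has vertex set $V(T)$ and adjacency function $-\theta$. For $X\subseteq V(T)$, $T|X$ is the trigraph on $X$ with $\theta$ restricted, and $T\setminus X=T|(V(T)\setminus X)$; $T$ contains $H$ if $H$ is isomorphic to some $T|X$. A clique (strong clique) is a set of pairwise adjacent (strongly adjacent) vertices; a strongly stable set is a set of pairwise strongly antiadjacent vertices; $T$ is complete if $V(T)$ is a clique. The full realization of $T$ is the graph on $V(T)$ whose edges are the adjacent pairs. A path is a sequence of distinct vertices $p_1,\dots,p_k$ such that $p_i,p_j$ are adjacent when $|i-j|=1$ and antiadjacent when $|i-j|>1$; its length is $k-1$. A hole of length $k\ge5$ consists of vertices $h_1,\dots,h_k$ with $h_i,h_j$ adjacent if $|i-j|\in\{1,k-1\}$ and antiadjacent otherwise; an antihole is an induced subtrigraph whose complement is a hole of $\overline T$ (length = number of vertices).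 $T$ is Berge if it contains no hole of odd length and no antihole of odd length. An even pair of $T$ is a strongly antiadjacent pair $\{u,v\}$ such that every path from $u$ to $v$ in $T$ has even length. $\Sigma(T)$ is the graph on $V(T)$ whose edges are the switchable pairs of $T$; a switchable component is a connected component of $\Sigma(T)$ with at least two vertices. $\mathcal F$ is the class of Berge trigraphs $T$ such that: (1) $T$ has at most one switchable component, and it has at most two edges; (2) if the switchable component has exactly one edge $xy$, then $N(x)\cap N(y)=\emptyset$ (it is called small); (3) if it has two edges, with $v$ the vertex of degree two in $\Sigma(T)$ and $x,y$ its neighbours, then $v$ is strongly anticomplete to $V(T)\setminus\{v,x,y\}$, $x$ is strongly antiadjacent to $y$, and $N(x)\cap N(y)=\{v\}$ (it is called light). For $T\in\mathcal F$, $D$ denotes the vertex set of its switchable component ($D=\emptyset$ if $T$ has no switchable pair). A pair $\{u,v\}$ is disjoint from the switchable component if $\{u,v\}\cap D=\emptyset$. A trigraph $T\in\mathcal F$ is favorable if (1) $|V(T)|\ge5$; (2) $T$ has a strongly antiadjacent pair $\{u,v\}$ disjoint from $D$; and (3) if $D=\{x,y\}$ is small, then at least one of $V(T)\setminus(D\cup N(x))$, $V(T)\setminus(D\cup N(y))$ is not a clique. $T$ is bipartite if $V(T)$ can be partitioned into two strongly stable sets. $T$ is a line trigraph if its full realization is the line graph of a bipartite graph and every clique of size at least $3$ in $T$ is a strong clique. $T$ is the complement of a bipartite (line) trigraph if $\overline T$ is a bipartite (line) trigraph. *)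

(* Defs.v *)
From HB Require Import structures.
From mathcomp Require Import all_boot.
Set Implicit Arguments. Unset Strict Implicit. Unset Printing Implicit Defensive.

(* Values of the adjacency function theta: 1 = Strong, 0 = Semi, -1 = Anti. *)
Inductive adjv := Strong | Semi | Anti.

Definition adjv_eqb (a b : adjv) : bool :=
  match a, b with
  | Strong, Strong | Semi, Semi | Anti, Anti => true | _, _ => false end.
Lemma adjv_eqP : Equality.axiom adjv_eqb.
Proof. by case; case; constructor. Qed.
HB.instance Definition _ := hasDecEq.Build adjv adjv_eqP.

Section Trigraph.
Variables (V : finType) (theta : V -> V -> adjv).

(* theta is only ever consulted on pairs of distinct vertices *)
Definition sadj (u v : V) : bool := (u != v) && (theta u v == Strong).
Definition santi (u v : V) : bool := (u != v) && (theta u v == Anti).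
Definition semi (u v : V) : bool := (u != v) && (theta u v == Semi).
Definition adj (u v : V) : bool := (u != v) && (theta u v != Anti).
Definition antiadj (u v : V) : bool := (u != v) && (theta u v != Strong).

Definition nbhd (x : V) : {set V} := [set y | adj x y].

Definition clique (X : {set V}) : Prop :=
  forall u v, u \in X -> v \in X -> u != v -> adj u v.
Definition strong_clique (X : {set V}) : Prop :=
  forall u v, u \in X -> v \in X -> u != v -> sadj u v.
Definition strongly_stable (X : {set V}) : Prop :=
  forall u v, u \in X -> v \in X -> u != v -> santi u v.

Definition complete : Prop := clique [set: V].

(* a path p_1, ..., p_k ; its length is k - 1 *)
Definition is_path (p : seq V) : Prop :=
  match p with
  | [::] => True
  | x0 :: _ =>
      uniq p /\
      forall i j, i < size p -> j < size p -> i < j ->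
        (j = i.+1 -> adj (nth x0 p i) (nth x0 p j)) /\
        (i.+1 < j -> antiadj (nth x0 p i) (nth x0 p j))
  end.

Definition is_hole (h : seq V) : Prop :=
  match h with
  | [::] => False
  | x0 :: _ =>
      uniq h /\ 5 <= size h /\
      forall i j, i < size h -> j < size h -> i != j ->
        let k := size h in
        (((i.+1 %% k == j) || (j.+1 %% k == i)) -> adj (nth x0 h i) (nth x0 h j)) /\
        (~~ ((i.+1 %% k == j) || (j.+1 %% k == i)) -> antiadj (nth x0 h i) (nth x0 h j))
  end.

Definition even_pair (u v : V) : Prop :=
  santi u v /\ forall q : seq V, is_path (u :: q) -> last u q = v -> ~~ odd (size q).

Definition sigma_rel : rel V := fun u v => semi u v.
Definition component (x : V) : {set V} := [set y | connect sigma_rel x y].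
Definition switch_comps : {set {set V}} :=
  [set C | [exists x, (C == component x) && (1 < #|C|)]].
Definition swD : {set V} := cover switch_comps.
Definition edges_in (C : {set V}) : {set {set V}} :=
  [set p | [exists u, exists v, [&& u \in C, v \in C, semi u v & p == [set u; v]]]].

End Trigraph.

Definition compl (V : finType) (theta : V -> V -> adjv) : V -> V -> adjv :=
  fun u v => match theta u v with Strong => Anti | Semi => Semi | Anti => Strong end.

Definition has_antihole (V : finType) (theta : V -> V -> adjv) : Prop :=
  exists h : seq V, is_hole (compl theta) h.

Definition berge (V : finType) (theta : V -> V -> adjv) : Prop :=
  ~ (exists h : seq V, is_hole theta h /\ odd (size h)) /\
  ~ (exists h : seq V, is_hole (compl theta) h /\ odd (size h)).

Definition inF (V : finType) (theta : V -> V -> adjv) : Prop :=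
  berge theta /\
  #|switch_comps theta| <= 1 /\
  forall C, C \in switch_comps theta ->
    #|edges_in theta C| <= 2 /\
    (#|edges_in theta C| = 1 ->
       forall x y, x \in C -> semi theta x y -> nbhd theta x :&: nbhd theta y = set0) /\
    (#|edges_in theta C| = 2 ->
       forall v x y, v \in C -> x != y -> semi theta v x -> semi theta v y ->
         [/\ forall w, w \notin [set v; x; y] -> santi theta v w,
             santi theta x y &
             nbhd theta x :&: nbhd theta y = [set v]]).

Definition favorable (V : finType) (theta : V -> V -> adjv) : Prop :=
  5 <= #|V| /\
  (exists u v, santi theta u v /\ u \notin swD theta /\ v \notin swD theta) /\
  (forall x y, semi theta x y -> swD theta = [set x; y] ->
     (~ clique theta (~: (swD theta :|: nbhd theta x))) \/
     (~ clique theta (~: (swD theta :|: nbhd theta y)))).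

Definition bipartite_trigraph (V : finType) (theta : V -> V -> adjv) : Prop :=
  exists A : {set V}, strongly_stable theta A /\ strongly_stable theta (~: A).

(* full realization is the line graph of a bipartite graph H: H has sides
   'I_m and 'I_n, its edges are the image of the injection f, and two distinct
   vertices are adjacent iff the corresponding edges share an end. *)
Definition line_trigraph (V : finType) (theta : V -> V -> adjv) : Prop :=
  (exists (m n : nat) (f : V -> 'I_m * 'I_n), injective f /\
     forall u v, u != v ->
       adj theta u v = ((f u).1 == (f v).1) || ((f u).2 == (f v).2)) /\
  (forall X : {set V}, 3 <= #|X| -> clique theta X -> strong_clique theta X).

(* Main.v *)
(** Let [e] be the graph of strongly antiadjacent pairs. The complement of [T]
    is diamond-free, so an odd path of [T] between the ends of an edge [uv] of
    [e] has length three, and such a path is a P4 of [e] with middle edge [uv]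
    (the two ends of a switchable pair have no common neighbour). So one needs
    an edge of [e] that is not the middle edge of a P4.

    Any graph without holes of length at least five that has an edge has such
    an edge. Take a maximal connected set [W] such that some edge is disjoint
    from the closed neighbourhood of [W], and by induction take such an edge
    [uv] for the graph induced on the set of vertices far from [W]. A P4
    [b-u-v-a] has [b] and [a] in the neighbourhood of [W], as by maximality each
    vertex of this neighbourhood meets or sees every far edge; then
    [b-u-v-a] closes into a hole through [W]. The argument also places [uv] far
    from any given vertex, provided an edge far from it exists. For the second
    part one deletes one end [x] of the switchable pair [xy] and stays far from
    [y]: the vertices obtained are strongly antiadjacent to [x], so no path of
    length three between them uses [x]. *)
Require Import Defs.
From mathcomp Require Import all_boot.
Set Implicit Arguments. Unset Strict Implicit. Unset Printing Implicit Defensive.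

(** * Induced paths and holes of a graph *)

Section Graph.
Variables (V : finType) (e : rel V).
Hypotheses (e_sym : symmetric e) (e_irr : irreflexive e).

Fixpoint induced_path (x : V) (p : seq V) : bool :=
  if p is y :: q then
    [&& e x y, x \notin p, ~~ has (e x) q & induced_path y q]
  else true.

Lemma induced_path_uniq x p : induced_path x p -> uniq (x :: p).
Proof. by elim: p x => //= y q IH x /and4P[_ -> _ /IH]. Qed.

Lemma induced_path_nth x0 x p i j :
  induced_path x p -> i < j -> j <= size p ->
  e (nth x0 (x :: p) i) (nth x0 (x :: p) j) = (j == i.+1).
Proof.
elim: p x i j => [|y q IH] x i j; first by case: j.
case/and4P=> exy _ nhas indq.
case: i j => [|i] [|j] // ltij lej; last exact: (IH y i j indq ltij lej).
case: j {ltij} lej => [|j] lej; first by rewrite /= exy.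
by apply: negbTE; apply: (hasPn nhas); rewrite /= mem_nth.
Qed.

Lemma induced_path_suffix x y q :
  induced_path y q -> x \in y :: q ->
  exists q', [/\ induced_path x q', last x q' = last y q
               & {subset x :: q' <= y :: q}].
Proof.
elim: q y => [|z q IH] y indq.
  by rewrite inE => /eqP ->; exists [::]; split.
rewrite inE => /predU1P[-> | xq]; first by exists (z :: q); split.
case/and4P: indq => _ _ _ /IH/(_ xq)[q' [indq' lq sub]].
by exists q'; split=> // t /sub tq; rewrite inE tq orbT.
Qed.

Lemma induced_path_last_neighbor x y q :
  induced_path y q -> has (e x) (y :: q) ->
  exists z q', [/\ induced_path z q', e x z, ~~ has (e x) q',
                   last z q' = last y q & {subset z :: q' <= y :: q}].
Proof.
elim: q y => [|z q IH] y indq.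
  by rewrite has_seq1 => exy; exists y, [::]; split.
have [hasq _ | nhasq] := boolP (has (e x) (z :: q)); last first.
  by rewrite /= -[e x z || _]/(has (e x) (z :: q)) (negbTE nhasq) orbF => exy;
    exists y, (z :: q); split.
case/and4P: indq => _ _ _ /IH/(_ hasq)[t [q' [indq' ext nhq' lq sub]]].
by exists t, q'; split=> // s /sub sq; rewrite inE sq orbT.
Qed.

(** Induction from the end of the walk: if [x] lies on the induced path found so far, keep the part
    from [x] on; otherwise jump from [x] to its last neighbour there, so that the path stays
    induced. *)
Lemma path_induced_path x p :
  path e x p ->
  exists q, [/\ induced_path x q, last x q = last x p
              & {subset x :: q <= x :: p}].
Proof.
elim: p x => [|y p IH] x; first by exists [::]; split.
case/andP=> exy /IH[q [indq lq sub]].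
have sub' : {subset y :: q <= x :: y :: p}.
  by move=> t /sub tp; rewrite inE tp orbT.
have [xq | nxq] := boolP (x \in y :: q).
  have [q' [indq' lq' subq']] := induced_path_suffix indq xq.
  exists q'; split=> //; first by rewrite lq' lq.
  by move=> t /subq' /sub'.
have hasq : has (e x) (y :: q) by rewrite /= exy.
have [z [q' [indq' exz nhq' lq' subq']]] := induced_path_last_neighbor indq hasq.
exists (z :: q'); split; first 1 last.
- by rewrite /= lq' lq.
- move=> t; rewrite inE => /predU1P[-> | /subq' /sub' //].
  by rewrite inE eqxx.
- by apply/and4P; split=> //; apply: contra nxq => /subq'.
Qed.

(** A hole is an induced path [x :: p] closed up by one more vertex [v]; at least four vertices on
    the path give length at least five. *)
Definition no_long_hole : Prop :=
  forall v x p, induced_path x p -> 3 <= size p -> v \notin x :: p ->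
    (forall z, z \in x :: p -> e v z = (z == x) || (z == last x p)) -> False.

(** * Connected sets and the vertices far from them *)

Definition connected_in (W : {set V}) : rel V :=
  [rel x y | [&& x \in W, y \in W & e x y]].

Definition connected_from (w : V) (W : {set V}) : bool :=
  (w \in W) && [forall t in W, connect (connected_in W) w t].

Definition far (W : {set V}) : {set V} :=
  [set z | (z \notin W) && [forall w in W, ~~ e w z]].

Definition has_edge (X : {set V}) : bool :=
  [exists u in X, exists v in X, e u v].

Lemma far_notin (W : {set V}) z : z \in far W -> z \notin W.
Proof. by rewrite inE => /andP[]. Qed.

Lemma far_nedge (W : {set V}) w z : z \in far W -> w \in W -> e w z = false.
Proof. by rewrite inE => /andP[_ /forall_inP H] /H/negbTE. Qed.

Lemma not_far (W : {set V}) z : z \notin W -> z \notin far W -> exists2 w, w \in W & e w z.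
Proof.
move=> zW; rewrite inE zW => /forall_inPn[w wW]; rewrite negbK => ewz.
by exists w.
Qed.

Lemma farU1 (W : {set V}) s : far (s |: W) = far W :&: far [set s].
Proof.
apply/setP=> z; rewrite !inE negb_or.
apply/idP/idP=> [/andP[/andP[zs zW] /forall_inP H] | ].
  rewrite zs zW; apply/andP; split; apply/forall_inP=> w wW; apply: H.
    by rewrite !inE wW orbT.
  by rewrite inE wW.
case/andP=> /andP[-> /forall_inP H1] /andP[-> /forall_inP H2].
by apply/forall_inP=> w; rewrite inE => /orP[]; [apply: H2 | apply: H1].
Qed.

Lemma connected_from_setU1 w (W : {set V}) s t :
  connected_from w W -> t \in W -> e t s -> connected_from w (s |: W).
Proof.
case/andP=> wW /forall_inP cW tW ets.
rewrite /connected_from !inE wW orbT /=.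
have mono x : x \in W -> connect (connected_in (s |: W)) w x.
  move=> /cW; apply: connect_sub => {}x y /and3P[xW yW exy].
  by apply: connect1; rewrite /connected_in /= !inE xW yW exy !orbT.
apply/forall_inP=> x; rewrite inE => /orP[]; last exact: mono.
rewrite inE => /eqP ->; apply: connect_trans (mono t tW) _.
by apply: connect1; rewrite /connected_in /= !inE eqxx tW ets orbT.
Qed.

Lemma connected_from_induced_path w (W : {set V}) a b :
  connected_from w W -> b \notin W -> a \notin W ->
  b \notin far W -> a \notin far W ->
  exists p, [/\ induced_path b p, last b p = a
              & {subset p <= [predU1 a & predU1 b (mem W)]}].
Proof.
case/andP=> wW /forall_inP cW bW aW.
case/(not_far bW)=> s sW esb /(not_far aW)[t tW eta].
have symW : connect_sym (connected_in W).
  by apply: sym_connect_sym => x y; rewrite /connected_in /= e_sym andbCA.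
have /connectP[p pW lp] : connect (connected_in W) s t.
  by rewrite (connect_trans _ (cW t tW)) // symW cW.
have sub : {subset s :: p <= W}.
  move=> x; rewrite inE => /predU1P[-> // | ].
  elim: p s {sW esb lp} pW => //= y p IH s /andP[/and3P[_ yW _] /IH {}IH].
  by rewrite inE => /predU1P[-> | /IH].
have ep : path e b (rcons (s :: p) a).
  rewrite /= rcons_path -lp eta andbT e_sym esb /=.
  by apply: sub_path pW => x y /and3P[].
have [q [indq lq subq]] := path_induced_path ep.
exists q; split=> //; first by rewrite lq last_rcons.
move=> x xq; have := subq x; rewrite inE xq orbT => /(_ isT).
rewrite inE mem_rcons inE => /or3P[/eqP-> | /eqP-> | /sub xW].
- by rewrite !inE eqxx orbT.
- by rewrite !inE eqxx.
- by rewrite !inE xW !orbT.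
Qed.

(** * Edges that are not the middle of a P4 *)

(** Relative to [X] for the induction on vertex sets. The conclusion [e a b] closes [b]-[u]-[v]-[a]
    into a 4-cycle. *)
Definition not_mid_P4 (X : {set V}) (u v : V) : Prop :=
  [/\ u \in X, v \in X, e u v &
      forall a b, a \in X -> b \in X -> a != u -> b != v ->
        e u b -> e v a -> ~~ e v b -> ~~ e u a -> e a b].

Hypothesis no_hole : no_long_hole.

Lemma no_P4_via_connected w (W : {set V}) a b u v :
  connected_from w W -> a \notin W -> b \notin W ->
  a \notin far W -> b \notin far W -> u \in far W -> v \in far W ->
  a != u -> b != v -> e u v -> e u b -> e v a -> ~~ e v b -> ~~ e u a -> e a b.
Proof.
move=> cW aW bW aF bF uF vF au bv euv eub eva nvb nua.
apply: contraT => nab.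
have [p [indp lp sub]] := connected_from_induced_path cW bW aW bF aF.
have ub : u != b by apply: contraTneq eub => ->; rewrite e_irr.
have va : v != a by apply: contraTneq eva => ->; rewrite e_irr.
have uv : u != v by apply: contraTneq euv => ->; rewrite e_irr.
have nba : b != a by apply: contraNneq nua => <-.
have nbp : b \notin p by case/andP: (induced_path_uniq indp).
have subW x : x \in p -> (x == a) || (x \in W).
  move=> xp; have := sub x xp; rewrite !inE => /or3P[-> // | /eqP xb | ->].
    by rewrite -xb xp in nbp.
  by rewrite orbT.
have notp z : z \in far W -> z != a -> z \notin p.
  move=> zF za; apply/negP=> /subW; rewrite (negbTE za) /=.
  by rewrite (negbTE (far_notin zF)).
(* The hole consists of [v] and the path from [u] over [b] and through [W] to [a]; the far vertices
   [u] and [v] see no vertex of [W]. *)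
exfalso; apply: (@no_hole v u (b :: p)).
- apply/and4P; split=> //; first by rewrite inE negb_or ub notp 1?eq_sym.
  apply/hasPn=> x /subW/orP[/eqP -> // | xW].
  by rewrite e_sym (far_nedge uF xW).
(* As [a] and [b] are distinct and nonadjacent, [p] has at least two vertices. *)
- case: p indp lp {sub nbp subW notp} => [|c [|d p]] //=.
    by move=> _ ba; rewrite ba eqxx in nba.
  by case/andP=> ebc _ ca; rewrite -ca e_sym ebc in nab.
- by rewrite !inE !negb_or eq_sym uv (eq_sym v) bv notp.
- move=> z; rewrite /= lp !inE => /or3P[/eqP-> | /eqP-> | zp].
  + by rewrite e_sym euv eqxx.
  + by rewrite (negbTE nvb) eq_sym (negbTE ub) (negbTE nba).
  + case/orP: (subW z zp) => [/eqP-> | zW]; first by rewrite eva eqxx orbT.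
    rewrite e_sym (far_nedge vF zW); symmetry; apply/norP; split.
      by apply: contraTneq zW => ->; apply: far_notin.
    by apply: contraTneq zW => ->.
Qed.

Lemma not_mid_P4_far w (W : {set V}) (X : {set V}) u v :
  connected_from w W ->
  (forall s, s \notin W -> s \notin far W -> ~~ has_edge (X :&: far (s |: W))) ->
  not_mid_P4 (X :&: far W) u v -> not_mid_P4 X u v.
Proof.
move=> cW maxW [/setIP[uX uF] /setIP[vX vF] euv good].
split=> // a b aX bX au bv eub eva nvb nua.
have aW : a \notin W by apply: contraTN eva => /(far_nedge vF); rewrite e_sym => ->.
have bW : b \notin W by apply: contraTN eub => /(far_nedge uF); rewrite e_sym => ->.
have ua : u != a by rewrite eq_sym.
(* If [s] missed both ends, the edge [tt'] would be far from [s |: W]. *)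
have nfar s t t' : t \in X :&: far W -> t' \in X :&: far W -> e t t' ->
    s \notin W -> s \notin far W -> t != s -> t' != s -> ~~ e s t -> e s t'.
  move=> /setIP[tX tF] /setIP[t'X t'F] ett' sW sF ts t's nst.
  apply: contraT => nst'; case/negP: (maxW s sW sF).
  apply/exists_inP; exists t; last first.
    apply/exists_inP; exists t' => //.
    rewrite farU1 !inE in t'F *; rewrite t'X t'F t's /=.
    by apply/forall_inP=> x; rewrite inE => /eqP->.
  rewrite farU1 !inE in tF *; rewrite tX tF ts /=.
  by apply/forall_inP=> x; rewrite inE => /eqP->.
have uXF : u \in X :&: far W by rewrite inE uX.
have vXF : v \in X :&: far W by rewrite inE vX.
have [aF | aF] := boolP (a \in far W); have [bF | bF] := boolP (b \in far W).
- by apply: good; rewrite // inE ?aX ?bX.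
(* Here [b] misses the end [v] of the far edge [va], so it sees [a]; the next case is symmetric. *)
- have aXF : a \in X :&: far W by rewrite inE aX.
  rewrite e_sym; apply: (nfar b v a) => //; rewrite 1?eq_sym //.
    by apply: contraNneq nua => <-.
  by rewrite e_sym.
- have bXF : b \in X :&: far W by rewrite inE bX.
  apply: (nfar a u b) => //; last by rewrite e_sym.
  by apply: contraNneq nua => <-.
- exact: (no_P4_via_connected cW aW bW aF bF uF vF).
Qed.

Lemma connected_from1 w : connected_from w [set w].
Proof.
rewrite /connected_from set11 /=; apply/forall_inP=> t.
by rewrite inE => /eqP->.
Qed.

(** The vertex [w] lies in [X] but not in [far W], so the induction hypothesis applies to
    [X :&: far W]. The set [W] may leave [X], as holes are excluded in the whole graph. *)
Lemma exists_not_mid_P4_far (X : {set V}) w :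
  (forall Y : {set V}, Y \proper X -> has_edge Y -> exists u v, not_mid_P4 Y u v) ->
  w \in X -> has_edge (X :&: far [set w]) ->
  exists u v, [/\ not_mid_P4 X u v, u \in far [set w] & v \in far [set w]].
Proof.
move=> IH wX edgew.
pose P (W : {set V}) := connected_from w W && has_edge (X :&: far W).
have [|W /maxsetP[/andP[cW edgeW] maxW] sub] := @maxset_exists _ P [set w].
  by rewrite /P connected_from1.
have wW : w \in W by case/andP: cW.
have farS z : z \in far W -> z \in far [set w].
  move=> zF; rewrite inE in_set1; apply/andP; split.
    by apply: contraTneq wW => <-; apply: far_notin.
  by apply/forall_inP=> x; rewrite inE => /eqP->; rewrite (far_nedge zF).
have propW : X :&: far W \proper X.
  apply/properP; split; first exact: subsetIl.
  by exists w => //; rewrite inE wX /=; apply: contraL wW => /far_notin.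
have [u [v good]] := IH _ propW edgeW.
exists u, v; split; last 2 first.
- by case: good => /setIP[_ /farS].
- by case: good => _ /setIP[_ /farS].
apply: (not_mid_P4_far cW) good => s sW sF.
have [t tW ets] := not_far sW sF.
apply/negP=> edges; have := maxW (s |: W).
rewrite /P edges (connected_from_setU1 cW tW ets) subsetUr => /(_ isT isT) eqW.
by rewrite -eqW setU11 in sW.
Qed.

(** Induction on the size of [X]. If no edge within [X] is far from a vertex of [X], every edge will
    do: in a P4 [b]-[u]-[v]-[a] the edge [va] would be far from [b]. *)
Lemma exists_not_mid_P4 (X : {set V}) :
  has_edge X -> exists u v, not_mid_P4 X u v.
Proof.
elim: {X}_.+1 {-2}X (ltnSn #|X|) => // n IH X leX edgeX.
have IHX (Y : {set V}) :
    Y \proper X -> has_edge Y -> exists u v, not_mid_P4 Y u v.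
  by move=> /proper_card ltY; apply: IH; apply: leq_trans ltY _.
have [/exists_inP[w wX edgew] | /exists_inPn nofar] :=
    boolP [exists w in X, has_edge (X :&: far [set w])].
  by have [u [v [good _ _]]] := exists_not_mid_P4_far IHX wX edgew; exists u, v.
case/exists_inP: edgeX => u uX /exists_inP[v vX euv].
exists u, v; split=> // a b aX bX au bv eub eva nvb nua.
apply: contraT => nab; case/negP: (nofar b bX).
have isfar z : z != b -> ~~ e b z -> z \in far [set b].
  move=> zb nbz; rewrite inE in_set1 zb; apply/forall_inP=> x.
  by rewrite inE => /eqP->.
apply/exists_inP; exists v.
  by rewrite inE vX isfar // 1?eq_sym // e_sym.
apply/exists_inP; exists a => //; rewrite inE aX isfar //.
  by apply: contraNneq nua => ->.
by rewrite e_sym.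
Qed.

Corollary exists_not_mid_P4_away (X : {set V}) w :
  w \in X -> has_edge (X :&: far [set w]) ->
  exists u v, [/\ not_mid_P4 X u v, u \in far [set w] & v \in far [set w]].
Proof.
by move=> wX; apply: exists_not_mid_P4_far => // Y _; apply: exists_not_mid_P4.
Qed.

End Graph.

(** * Adjacency in a trigraph and in its complement *)

Section Complement.
Variables (V : finType) (theta : V -> V -> adjv).

Lemma adj_compl u v : adj (compl theta) u v = antiadj theta u v.
Proof. by rewrite /adj /antiadj /compl; case: (theta u v). Qed.

Lemma antiadj_compl u v : antiadj (compl theta) u v = adj theta u v.
Proof. by rewrite /adj /antiadj /compl; case: (theta u v). Qed.

Lemma sadj_compl u v : sadj (compl theta) u v = santi theta u v.
Proof. by rewrite /sadj /santi /compl; case: (theta u v). Qed.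

Lemma santi_compl u v : santi (compl theta) u v = sadj theta u v.
Proof. by rewrite /sadj /santi /compl; case: (theta u v). Qed.

Lemma santi_nadj u v : santi theta u v -> ~~ adj theta u v.
Proof. by rewrite /adj /santi; case: (theta u v); rewrite !(andbT, andbF). Qed.

Lemma adj_nsanti u v : adj theta u v -> ~~ santi theta u v.
Proof. by apply: contraL => /santi_nadj. Qed.

Lemma nadj_santi u v : u != v -> ~~ adj theta u v -> santi theta u v.
Proof. by rewrite /adj /santi => ->; case: (theta u v). Qed.

Lemma antiadj_nsadj u v : antiadj theta u v -> ~~ sadj theta u v.
Proof. by rewrite /antiadj /sadj; case: (theta u v); rewrite !(andbT, andbF). Qed.

Lemma santi_antiadj u v : santi theta u v -> antiadj theta u v.
Proof. by rewrite /antiadj /santi; case: (theta u v); rewrite !(andbT, andbF). Qed.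

Lemma semi_antiadj u v : semi theta u v -> antiadj theta u v.
Proof. by rewrite /antiadj /semi; case: (theta u v); rewrite !(andbT, andbF). Qed.

Lemma semi_nsanti u v : semi theta u v -> ~~ santi theta u v.
Proof. by rewrite /santi /semi; case: (theta u v); rewrite !(andbT, andbF). Qed.

Lemma antiadj_cases u v : antiadj theta u v -> santi theta u v \/ semi theta u v.
Proof.
rewrite /antiadj /santi /semi; case: (theta u v); rewrite ?(andbT, andbF) //.
  by right.
by left.
Qed.

Lemma antiadj_neq u v : antiadj theta u v -> u != v.
Proof. by case/andP. Qed.

Lemma adj_neq u v : adj theta u v -> u != v.
Proof. by case/andP. Qed.

Lemma path_adj x0 p i :
  is_path theta p -> i.+1 < size p -> adj theta (nth x0 p i) (nth x0 p i.+1).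
Proof.
case: p => // x p [_ ip] lti.
rewrite !(@set_nth_default _ (x :: p) x) ?(ltnW lti) //.
by case: (ip i i.+1 (ltnW lti) lti (ltnSn i)) => ->.
Qed.

Lemma path_antiadj x0 p i j :
  is_path theta p -> i.+1 < j -> j < size p -> antiadj theta (nth x0 p i) (nth x0 p j).
Proof.
case: p => // x p [_ ip] ltij ltj.
have lti : i < size (x :: p) by apply: ltn_trans (ltnW ltij) ltj.
rewrite !(@set_nth_default _ (x :: p) x) //.
by case: (ip i j lti ltj (ltnW ltij)) => _ ->.
Qed.

(** * Antiholes as holes of the graph of strong antiadjacency *)

Hypothesis theta_sym : forall u v, theta u v = theta v u.

Lemma santi_sym : symmetric (santi theta).
Proof. by move=> u v; rewrite /santi eq_sym theta_sym. Qed.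

Lemma santi_irr : irreflexive (santi theta).
Proof. by move=> u; rewrite /santi eqxx. Qed.

Lemma antiadj_sym : symmetric (antiadj theta).
Proof. by move=> u v; rewrite /antiadj eq_sym theta_sym. Qed.

Lemma adj_sym : symmetric (adj theta).
Proof. by move=> u v; rewrite /adj eq_sym theta_sym. Qed.

Lemma semi_sym : symmetric (semi theta).
Proof. by move=> u v; rewrite /semi eq_sym theta_sym. Qed.

Lemma no_long_hole_santi : ~ has_antihole theta -> no_long_hole (santi theta).
Proof.
move=> noah v x p indp le3 vxp ev; apply: noah; exists (v :: x :: p).
have uxp := induced_path_uniq indp.
have us : uniq (v :: x :: p) by rewrite cons_uniq vxp.
split=> //; split=> //.
set s := v :: x :: p; set k := size s.
(* Index [0] is [v] and index [i.+1] is position [i] of [x :: p]; the modulus wraps only at the last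
   index [(size p).+1], which closes the cycle at [v]. *)
have suff_lt : forall i j, i < j -> j < k ->
    santi theta (nth v s i) (nth v s j) = (i.+1 %% k == j) || (j.+1 %% k == i).
  move=> [|i] [|j] // ltij ltj; have lej : j <= size p by [].
    rewrite [nth v s 0]/= [nth v s j.+1]/= ev ?mem_nth //.
    have -> : last x p = nth v (x :: p) (size p) by rewrite (last_nth v).
    rewrite -[X in _ == X]/(nth v (x :: p) 0) !nth_uniq //.
    rewrite modn_small // eqSS (eq_sym 0); congr (_ || _).
    have [-> | nej] := eqVneq j (size p); first by rewrite modnn.
    by rewrite modn_small // ltnS ltnS ltn_neqAle nej.
  rewrite [nth v s i.+1]/= [nth v s j.+1]/= (induced_path_nth santi_irr v indp) //.
  have -> : i.+2 %% k = i.+2.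
    by apply: modn_small; apply: (leq_trans (ltij : i < j) lej).
  rewrite eqSS (eq_sym j); have [-> | nej] := eqVneq j (size p).
    by rewrite modnn orbF.
  rewrite [j.+2 %% k]modn_small ?ltnS 1?ltn_neqAle ?nej // eqSS.
  by rewrite [j.+1 == i]gtn_eqF ?orbF // ltnS ltnW.
have suff_neq i j : i < k -> j < k -> i != j ->
    santi theta (nth v s i) (nth v s j) = (i.+1 %% k == j) || (j.+1 %% k == i).
  move=> lti ltj; rewrite neq_ltn => /orP[]; first by move/suff_lt->.
  by move/suff_lt=> H; rewrite santi_sym orbC H.
move=> i j lti ltj neij /=; rewrite adj_compl antiadj_compl.
rewrite -(suff_neq i j) //; split; first exact: santi_antiadj.
move=> nij; apply: contraR nij; apply: nadj_santi.
by rewrite nth_uniq.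
Qed.

(** * Triangles and diamonds of the complement *)

Lemma card_set3 (a b c : V) : a != b -> b != c -> a != c -> #|[set a; b; c]| = 3.
Proof.
move=> ab bc ac; rewrite setUC cardsU1 cards2 ab !inE negb_or.
by rewrite eq_sym ac eq_sym bc.
Qed.

(** The two sides are strong cliques of [theta], so antiadjacent vertices lie on opposite sides,
    which three vertices cannot do pairwise. *)
Lemma co_bipartite_triangle_free a b c :
  bipartite_trigraph (compl theta) ->
  antiadj theta a b -> antiadj theta b c -> antiadj theta a c -> False.
Proof.
case=> A [sA sB] ab bc ac.
have side x y : antiadj theta x y -> (x \in A) != (y \in A).
  move=> xy; apply: contraNneq (antiadj_nsadj xy) => eqA.
  rewrite -santi_compl; have [xA | xA] := boolP (x \in A).
    by apply: sA; rewrite -?eqA // antiadj_neq.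
  by apply: sB; rewrite ?inE -?eqA // antiadj_neq.
move: (side _ _ ab) (side _ _ bc) (side _ _ ac).
by case: (a \in A) (b \in A) (c \in A) => [] [] [].
Qed.

Hypothesis Hcl : bipartite_trigraph (compl theta) \/ line_trigraph (compl theta).

(** Vacuous in the bipartite case; in the line case a clique of size three of the complement is
    strong. *)
Lemma antiadj_triangle a b c :
  antiadj theta a b -> antiadj theta b c -> antiadj theta a c -> santi theta a b.
Proof.
move=> ab bc ac; case: Hcl => [bip | [_ strong]].
  by case: (co_bipartite_triangle_free bip ab bc ac).
rewrite -sadj_compl; apply: (strong [set a; b; c]).
- by rewrite card_set3 // antiadj_neq.
- move=> u v; rewrite !inE -!orbA adj_compl.
  by do 2![case/or3P=> /eqP->]; rewrite ?eqxx // ?ab ?bc ?ac // antiadj_sym.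
- by rewrite !inE eqxx.
- by rewrite !inE eqxx orbT.
- exact: antiadj_neq.
Qed.

(** In the line case [a] and [b] are disjoint edges of a bipartite graph, and [c] and [d] are
    distinct edges meeting both. Only two such edges are possible and they are disjoint, so [c] and
    [d] cannot meet. *)
Lemma antiadj_diamond_free a b c d :
  adj theta a b -> antiadj theta a c -> antiadj theta b c -> antiadj theta a d ->
  antiadj theta b d -> antiadj theta c d -> False.
Proof.
move=> adjab ac bc ad bd cd.
have nab : ~~ antiadj theta a b.
  by apply: contraL adjab => ab; apply/santi_nadj/(antiadj_triangle ab bc ac).
case: Hcl => [bip | [[m [n [f [injf fE]]]] _]].
  exact: (co_bipartite_triangle_free bip ac cd ad).
have share x y : antiadj theta x y -> (f x).1 = (f y).1 \/ (f x).2 = (f y).2.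
  move=> xy; move: (fE x y (antiadj_neq xy)); rewrite adj_compl xy.
  by case/esym/orP=> /eqP; [left | right].
have : f c <> f d by move/injf=> eqcd; rewrite eqcd /antiadj eqxx in cd.
have : ~ ((f a).1 = (f b).1 \/ (f a).2 = (f b).2).
  move=> shab; case/negP: nab; rewrite -adj_compl fE ?adj_neq //.
  by case: shab => ->; rewrite eqxx ?orbT.
move: (share _ _ ac) (share _ _ bc) (share _ _ ad) (share _ _ bd) (share _ _ cd).
case: (f a) (f b) (f c) (f d) => [a1 a2] [b1 b2] [c1 c2] [d1 d2] /=.
by intuition congruence.
Qed.

(** * Odd paths between strongly antiadjacent vertices *)

Lemma odd_path_length3 u v q :
  is_path theta (u :: q) -> last u q = v -> santi theta u v -> odd (size q) ->
  exists a b, q = [:: a; b; v].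
Proof.
move=> puq lq suv oq.
have padj := @path_adj u _ _ puq; have panti := @path_antiadj u _ _ _ puq.
case: q oq lq puq padj panti => [|a [|b [|c [|d [|f q]]]]] //= _ lq _ padj panti.
- by have := padj 0 isT; rewrite /= lq (negbTE (santi_nadj suv)).
- by exists a, b; rewrite lq.
(* From length five on, the vertices at positions 0, 1, 3 and 5, of which only the first two are
   consecutive, form a diamond of the complement. *)
- case: (@antiadj_diamond_free u a c f).
  + exact: (padj 0).
  + exact: (panti 0 3).
  + exact: (panti 1 3).
  + exact: (panti 0 5).
  + exact: (panti 1 5).
  + exact: (panti 3 5).
Qed.

(** On a path [u]-[a]-[b]-[v] the pairs [ub] and [av] cannot be switchable, since [a], respectively
    [b], would be a common neighbour. Hence [b]-[u]-[v]-[a] is a P4 of strong antiadjacency. *)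
Lemma even_pair_of_no_P4 u v :
  (forall x y z, semi theta x y -> adj theta x z -> adj theta y z -> False) ->
  santi theta u v ->
  (forall a b, adj theta u a -> adj theta a b -> adj theta b v ->
     santi theta u b -> santi theta a v -> False) ->
  even_pair theta u v.
Proof.
move=> semiN suv noP4; split=> // q puq lq; apply/negP=> oq.
have [a [b eq_q]] := odd_path_length3 puq lq suv oq.
rewrite {}eq_q in puq {lq oq}.
have ua : adj theta u a := path_adj u puq (isT : 1 < 4).
have ab : adj theta a b := path_adj u puq (isT : 2 < 4).
have bv : adj theta b v := path_adj u puq (isT : 3 < 4).
have ub : antiadj theta u b by exact: (@path_antiadj u _ 0 2 puq).
have av : antiadj theta a v by exact: (@path_antiadj u _ 1 3 puq).
case: (antiadj_cases ub) => [sub | /semiN/(_ ua)]; last first.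
  by rewrite adj_sym; apply.
case: (antiadj_cases av) => [sav | sav]; first exact: (noP4 a b).
by apply: (semiN _ _ b sav ab); rewrite adj_sym.
Qed.

(** * The switchable component as a single pair *)

Hypothesis HF : inF theta.

Lemma component_switch x y : semi theta x y -> component theta x \in switch_comps theta.
Proof.
move=> sxy; rewrite inE; apply/existsP; exists x; rewrite eqxx /=.
apply/card_gt1P; exists x, y; split; rewrite ?inE ?connect0 //.
  exact: connect1.
exact: antiadj_neq (semi_antiadj sxy).
Qed.

Lemma component_edge x y z :
  semi theta x y -> connect (sigma_rel theta) z x ->
  [set x; y] \in edges_in theta (component theta z).
Proof.
move=> sxy zx; rewrite inE; apply/existsP; exists x; apply/existsP; exists y.
by rewrite !inE zx sxy eqxx (connect_trans zx) // connect1.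
Qed.

(* A light component would be a triangle of the complement with a switchable edge. *)
Lemma semi_partner_unique v y z : semi theta v y -> semi theta v z -> y = z.
Proof.
move=> svy svz; case: HF => _ [_ /(_ _ (component_switch svy))[le2 [_ light]]].
apply/eqP; apply: contraT => yz.
have neq : [set v; y] != [set v; z].
  apply/eqP=> /setP/(_ y); rewrite !inE eqxx orbT (negbTE yz) orbF.
  by rewrite eq_sym (negbTE (antiadj_neq (semi_antiadj svy))).
have eq2 : #|edges_in theta (component theta v)| = 2.
  apply/eqP; rewrite eqn_leq le2; apply/card_gt1P.
  by exists [set v; y], [set v; z]; split=> //; apply: component_edge.
have vC : v \in component theta v by rewrite inE connect0.
have [_ /santi_antiadj ayz _] := light eq2 v y z vC yz svy svz.
have := antiadj_triangle (semi_antiadj svy) ayz (semi_antiadj svz).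
by rewrite (negbTE (semi_nsanti svy)).
Qed.

(** As partners are unique, [[set x; y]] is closed under semiadjacency. *)
Lemma component_semi x y : semi theta x y -> component theta x = [set x; y].
Proof.
move=> sxy; have syx : semi theta y x by rewrite semi_sym.
have cl : closed (sigma_rel theta) [set x; y].
  apply: intro_closed => [|u w]; first by apply: sym_connect_sym; exact: semi_sym.
  rewrite /sigma_rel !inE => suw /orP[] /eqP equ; rewrite {}equ in suw.
    by rewrite (semi_partner_unique suw sxy) eqxx orbT.
  by rewrite (semi_partner_unique suw syx) eqxx.
apply/setP=> z; rewrite inE; apply/idP/idP=> [/(closed_connect cl) <- | ].
  by rewrite !inE eqxx.
by rewrite !inE => /orP[] /eqP->; rewrite ?connect0 // connect1.
Qed.

Lemma swD_semi x y : semi theta x y -> swD theta = [set x; y].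
Proof.
move=> sxy; case: HF => _ [/card_le1_eqP le1 _].
rewrite -(component_semi sxy) /swD.
suff -> : switch_comps theta = [set component theta x] by rewrite cover1.
apply/setP=> C; rewrite in_set1; apply/idP/eqP=> [sC | ->].
  by apply: le1 => //; apply: component_switch sxy.
exact: component_switch sxy.
Qed.

Lemma swD_no_semi : (forall x y, ~~ semi theta x y) -> swD theta = set0.
Proof.
move=> nosemi; apply/setP=> u; rewrite inE; apply/negP=> /bigcupP[C].
rewrite inE => /existsP[x /andP[/eqP-> /card_gt1P[y [z [yC zC neyz]]]]] _.
have cl : closed (sigma_rel theta) [set x].
  by move=> a b; rewrite /sigma_rel (negbTE (nosemi a b)).
move: yC zC neyz; rewrite !inE => /(closed_connect cl) + /(closed_connect cl).
by rewrite !inE eqxx => /esym/eqP-> /esym/eqP->; rewrite eqxx.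
Qed.

(** The component of [x] is the pair itself and has a single edge, so the condition on small
    components applies. *)
Lemma semi_no_common_neighbor x y z :
  semi theta x y -> adj theta x z -> adj theta y z -> False.
Proof.
move=> sxy xz yz; case: HF => _ [_ /(_ _ (component_switch sxy))[_ [small _]]].
have eq1 : #|edges_in theta (component theta x)| = 1.
  apply/eqP/cards1P; exists [set x; y]; apply/setP=> E; rewrite in_set1.
  apply/idP/eqP=> [| ->]; last exact: component_edge sxy (connect0 _ _).
  rewrite inE => /existsP[u /existsP[w /and4P[uC wC suw /eqP->]]].
  move: uC wC; rewrite (component_semi sxy) !inE.
  have nuw := antiadj_neq (semi_antiadj suw).
  case/orP=> /eqP eu /orP[] /eqP ew.
  - by rewrite eu ew eqxx in nuw.
  - by rewrite eu ew.
  - by rewrite eu ew setUC.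
  - by rewrite eu ew eqxx in nuw.
have xC : x \in component theta x by rewrite inE connect0.
by have /setP/(_ z) := small eq1 x y xC sxy; rewrite !inE xz yz.
Qed.

(** * Even pairs, first anywhere, then off the switchable pair *)

Hypothesis Hnoah : ~ has_antihole theta.

Lemma even_pair_of_santi u v :
  santi theta u v -> exists u' v', even_pair theta u' v'.
Proof.
move=> suv; have edge : has_edge (santi theta) setT.
  by apply/exists_inP; exists u => //; apply/exists_inP; exists v.
have [u' [v' [_ _ suv' good]]] :=
  exists_not_mid_P4 santi_sym santi_irr (no_long_hole_santi Hnoah) edge.
exists u', v'; apply: even_pair_of_no_P4 => // [|a b ua ab bv ub av].
  exact: semi_no_common_neighbor.
(* The choice of [u] and [v] would make [a] and [b] strongly antiadjacent, but they are adjacent. *)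
case/negP: (adj_nsanti ab); apply: good => //.
- by rewrite eq_sym adj_neq.
- exact: adj_neq.
- by rewrite santi_sym.
- by rewrite santi_sym adj_nsanti.
- exact: adj_nsanti.
Qed.

Lemma even_pair_off_semi x y :
  semi theta x y -> ~ clique theta (~: (swD theta :|: nbhd theta x)) ->
  exists u v, [/\ even_pair theta u v, u \notin swD theta & v \notin swD theta].
Proof.
move=> sxy; rewrite (swD_semi sxy) => ncl.
have xy := antiadj_neq (semi_antiadj sxy).
set X := ~: _ in ncl.
have XP z : z \in X -> [/\ z != x, z != y & santi theta z x].
  rewrite !inE !negb_or => /andP[/andP[zx zy] nxz]; split=> //.
  by rewrite santi_sym nadj_santi // eq_sym.
(* If [z] were strongly antiadjacent to [y], then [x], [y], [z] would be a triangle of the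
   complement containing a switchable pair. *)
have Xfar z : z \in X -> z \in far (santi theta) [set y].
  move=> /XP[zx zy szx]; rewrite inE in_set1 zy; apply/forall_inP=> w.
  rewrite inE => /eqP->; apply/negP=> /santi_antiadj syz.
  have := antiadj_triangle (semi_antiadj sxy) syz.
  rewrite antiadj_sym santi_antiadj // => /(_ isT).
  by rewrite (negbTE (semi_nsanti sxy)).
(* Only [x] is deleted; being far from [y] already keeps the edge off [y]. *)
have edge : has_edge (santi theta) ([set~ x] :&: far (santi theta) [set y]).
  apply: contraT => noedge; case: ncl => a b aX bX ab.
  apply: contraT => nab; case/negP: noedge.
  have [/XP[ax _ _] /XP[bx _ _]] := (aX, bX).
  apply/exists_inP; exists a; first by rewrite in_setI in_setC1 ax Xfar.
  apply/exists_inP; exists b; first by rewrite in_setI in_setC1 bx Xfar.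
  exact: nadj_santi.
have yX : y \in [set~ x] by rewrite in_setC1 eq_sym.
have [u [v [[ux vx suv good] uF vF]]] := exists_not_mid_P4_away
  santi_sym santi_irr (no_long_hole_santi Hnoah) yX edge.
(* Vertices far from [y] are adjacent to [y], hence not to [x]. *)
have farP z : z != x -> z \in far (santi theta) [set y] -> z != y /\ ~~ adj theta x z.
  move=> zx; rewrite inE in_set1 => /andP[zy /forall_inP/(_ y (set11 y)) nyz].
  split=> //; apply/negP=> xz; apply: (semi_no_common_neighbor sxy xz).
  by apply: contraNT nyz; apply: nadj_santi; rewrite eq_sym.
rewrite !in_setC1 in ux vx.
have [uy nxu] := farP u ux uF; have [vy nxv] := farP v vx vF.
exists u, v; split; try by rewrite !inE negb_or ?ux ?vx.
apply: even_pair_of_no_P4 => // [|a b ua ab bv ub av].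
  exact: semi_no_common_neighbor.
(* Neither [u] nor [v] is adjacent to [x], so [a] and [b] avoid [x] and lie in the set for which the
   edge [uv] was chosen. *)
have ax : a != x by apply: contraNneq nxu => <-; rewrite adj_sym.
have bx : b != x by apply: contraNneq nxv => <-.
case/negP: (adj_nsanti ab); apply: good; rewrite ?in_setC1 //.
- by rewrite eq_sym adj_neq.
- exact: adj_neq.
- by rewrite santi_sym.
- by rewrite santi_sym adj_nsanti.
- exact: adj_nsanti.
Qed.

End Complement.

Theorem theorem4p9 (V : finType) (theta : V -> V -> adjv)
  (theta_sym : forall u v, theta u v = theta v u)
  (HF : inF theta)
  (Hnoah : ~ has_antihole theta)
  (Hcl : bipartite_trigraph (compl theta) \/ line_trigraph (compl theta)) :
  (complete theta \/ exists u v, even_pair theta u v) /\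
  (favorable theta ->
     exists u v, even_pair theta u v /\ u \notin swD theta /\ v \notin swD theta).
Proof.
split.
  have [/existsP[u /existsP[v suv]] | nosanti] :=
      boolP [exists u, exists v, santi theta u v].
    by right; apply: (even_pair_of_santi theta_sym Hcl HF Hnoah suv).
  left=> u v _ _ uv; apply: contraT => /(nadj_santi uv) suv.
  by case/existsP: nosanti; exists u; apply/existsP; exists v.
move=> [_ [[u [v [suv _]]] fav]].
have [/existsP[x /existsP[y sxy]] | nosemi] :=
    boolP [exists x, exists y, semi theta x y]; last first.
  have [u' [v' ev]] := even_pair_of_santi theta_sym Hcl HF Hnoah suv.
  exists u', v'; split=> //; rewrite swD_no_semi ?inE // => x y.
  by apply: contra nosemi => sxy; apply/existsP; exists x; apply/existsP; exists y.
have syx : semi theta y x by rewrite semi_sym.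
have sD := swD_semi theta_sym Hcl HF sxy.
(* The end whose set of non-neighbours outside the pair is not a clique is the one to be deleted. *)
by case: (fav x y sxy sD) => /even_pair_off_semi;
  [move/(_ theta_sym Hcl HF Hnoah y sxy) | move/(_ theta_sym Hcl HF Hnoah x syx)];
  case=> u' [v' [ev u'D v'D]]; exists u', v'.
Qed.
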